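(* Let $m\ge2$ be an integer and let $0<\rho_1,\rho_2,\ldots,\rho_m<1$ satisfy $\rho_1+\rho_2+\cdots+\rho_m<1$. Put $\gamma:=(1-\rho_1-\rho_2-\cdots-\rho_m)/(m-1)$ and let $K\subset\mathbb{R}$ be the self-similar set generated by the maps \[ \phi_i(x)=\rho_i x+\sum_{k=1}^{i-1}\rho_k+(i-1)\gamma,\qquad 1\le i\le m. \] Let $f$ be a contractive similitude on $\mathbb{R}$ such that $f(K)\subset K$. Then there exists a finite word $\mathbf{i}\in\Omega_m^*$ such that $f(K)=\phi_{\mathbf{i}}(K)$. Moreover, for this $\mathbf{i}$: (i) if $1-K\ne K$, then $f(x)=\phi_{\mathbf{i}}(x)$ for all $x\in\mathbb{R}$; (ii) if $1-K=K$, then $f(x)=\phi_{\mathbf{i}}(x)$ for all $x\in\mathbb{R}$ or $f(x)=\phi_{\mathbf{i}}(1-x)$ for all $x\in\mathbb{R}$.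
   Context: A contractive similitude on $\mathbb{R}$ is a map $f(x)=rx+t$ with $0<|r|<1$ and $t\in\mathbb{R}$. The self-similar set generated by contractive similitudes $\phi_1,\ldots,\phi_m$ is the unique non-empty compact set $K\subset\mathbb{R}$ with $K=\bigcup_{i=1}^m\phi_i(K)$. $\Omega_m^*$ is the set of all finite words over the alphabet $\{1,2,\ldots,m\}$, including the empty word. For $\mathbf{i}=i_1i_2\ldots i_n\in\Omega_m^*$, $\phi_{\mathbf{i}}:=\phi_{i_1}\circ\phi_{i_2}\circ\cdots\circ\phi_{i_n}$, and $\phi_{\emptyset}$ is the identity map. $1-K$ denotes $\{1-x:x\in K\}$. *)

(* Defs.v *)
From mathcomp Require Import all_boot all_order all_algebra.
From mathcomp Require Import all_classical all_reals all_analysis.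
Set Implicit Arguments.
Unset Strict Implicit.
Unset Printing Implicit Defensive.
Import Order.TTheory GRing.Theory Num.Theory.
Import numFieldNormedType.Exports.
Local Open Scope classical_set_scope.
Local Open Scope ring_scope.

Definition contractive_similitude (R : realType) (f : R -> R) : Prop :=
  exists r t : R, [/\ 0 < `|r|, `|r| < 1 & forall x : R, f x = r * x + t].

(* Being "the" self-similar set: for contractive similitudes such a set exists
   and is unique (Hutchinson), so these properties determine [K]. *)
Definition self_similar_set (R : realType) (m : nat)
    (phi : 'I_m -> R -> R) (K : set R) : Prop :=
  [/\ K !=set0, compact K & K = \bigcup_(i in [set: 'I_m]) (phi i @` K)].

Definition phi_word (R : realType) (m : nat) (phi : 'I_m -> R -> R)
    (w : seq 'I_m) : R -> R :=
  foldr (fun i g => phi i \o g) idfun w.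

Definition gap (R : realType) (m : nat) (rho : 'I_m -> R) : R :=
  (1 - \sum_(k < m) rho k) / (m%:R - 1).

(* The alphabet is ['I_m] = {0, ..., m - 1}, so the index [i] here is the
   1-based index minus one: [(i - 1) * gamma] becomes [i%:R * gap rho], and
   the sum over the indices before the i-th one is over [k < i]. *)
Definition ifs_map (R : realType) (m : nat) (rho : 'I_m -> R)
    (i : 'I_m) (x : R) : R :=
  rho i * x + \sum_(k < m | (k < i)%N) rho k + i%:R * gap rho.

(* Main.v *)
(* Only the gap at the first level matters: every hole of [K] has length at
   most [gamma], so every hole of [f(K)], for a ratio [r] with [`|r| < 1], is
   shorter than [gamma].  As the first-level cylinders are separated by holes of
   [K] of length exactly [gamma], [f(K)] lies inside a single [phi_i(K)].
   Replacing [f] by [phi_i^-1 \o f] multiplies the ratio by [1 / rho_i], so this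
   stops after finitely many steps, with an isometry mapping [K] into [K]; since
   [0] and [1] are the extreme points of [K], it is [x] or [1 - x]. *)
Require Import Defs.
From mathcomp Require Import all_boot all_order all_algebra.
From mathcomp Require Import all_classical all_reals all_analysis.
From mathcomp Require Import ring lra.
Set Implicit Arguments.
Unset Strict Implicit.
Unset Printing Implicit Defensive.
Import Order.TTheory GRing.Theory Num.Theory.
Import numFieldNormedType.Exports.
Local Open Scope classical_set_scope.
Local Open Scope ring_scope.

Section EqualGapIFS.
Variables (R : realType) (m : nat) (rho : 'I_m -> R).
Hypothesis hm : (2 <= m)%N.
Hypothesis rho_bounds : forall i : 'I_m, 0 < rho i < 1.
Hypothesis rho_sum : \sum_(i < m) rho i < 1.

Let phi := ifs_map rho.
Let gamma := gap rho.

(** * Positions of the first-level cylinders *)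

Lemma rho_gt0 i : 0 < rho i.
Proof. by case/andP: (rho_bounds i). Qed.

Lemma gap_gt0 : 0 < gamma.
Proof.
by rewrite divr_gt0 ?subr_gt0 // ltr1n.
Qed.

(** Left end of the [n]-th cylinder. A natural index also admits [n = m], a fictitious cylinder
    starting at [1 + gamma], so [offset i.+1 - gamma] is the right end of cylinder [i] even for the
    last [i]. *)
Definition offset (n : nat) : R := \sum_(k < m | (k < n)%N) rho k + n%:R * gamma.

Lemma ifs_mapE i x : phi i x = rho i * x + offset i.
Proof. by rewrite /phi /ifs_map addrA. Qed.

Lemma offset0 : offset 0 = 0.
Proof. by rewrite /offset big_pred0 // mul0r addr0. Qed.

Lemma offset_size : offset m = 1 + gamma.
Proof.
rewrite /offset (eq_bigl xpredT) => [|k]; last by rewrite ltn_ord.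
have m1_neq0 : m%:R - 1 != 0 :> R.
  by rewrite gt_eqF // subr_gt0 ltr1n.
by rewrite /gamma /gap; field.
Qed.

Lemma offsetS (i : 'I_m) : offset i.+1 = offset i + rho i + gamma.
Proof.
rewrite /offset (bigD1 i) //= -natr1.
rewrite (eq_bigl (fun k : 'I_m => (k < i)%N)) => [|k]; first by ring.
by rewrite ltnS ltn_neqAle andbC.
Qed.

Lemma offset_le n p : (n <= p)%N -> offset n <= offset p.
Proof.
move=> le_np; apply: lerD; last first.
  by rewrite ler_wpM2r ?ler_nat // ltW // gap_gt0.
rewrite big_mkcond [leRHS]big_mkcond /=; apply: ler_sum => k _.
case: ifP => [lt_kn|_]; first by rewrite (leq_trans lt_kn).
by case: ifP => // _; rewrite ltW ?rho_gt0.
Qed.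

Lemma offset_end (i : 'I_m) : offset i + rho i <= 1.
Proof. by have := offset_le (ltn_ord i); rewrite offset_size offsetS lerD2r. Qed.

Lemma offset_ge0 n : 0 <= offset n.
Proof. by rewrite -offset0 offset_le. Qed.

(** A common upper bound below 1 for all ratios; its powers measure progress in both inductions. *)
Let lambda := \sum_(i < m) rho i.

Lemma rho_le_sum i : rho i <= lambda.
Proof.
rewrite /lambda (bigD1 i) //= lerDl sumr_ge0 // => k _.
by rewrite ltW ?rho_gt0.
Qed.

Lemma expr_lambda_small e : 0 < e -> exists n, lambda ^+ n < e.
Proof.
move=> e_gt0.
have lambda_ge0 : 0 <= lambda by rewrite sumr_ge0 // => k _; rewrite ltW ?rho_gt0.
have /cvg_expr/cvgr_lt/(_ _ e_gt0)[n _ small] : `|lambda| < 1 by rewrite ger0_norm.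
by exists n; apply: small => /=.
Qed.

(** Zooming into cylinder [i] multiplies lengths by [1 / rho i], at least [1 / lambda], which saves
    one power of [lambda]. *)
Lemma expr_lambda_div n s i :
  lambda ^+ n.+1 < s -> lambda ^+ n < s / rho i.
Proof.
rewrite ltr_pdivlMr ?rho_gt0 // exprSr; apply: le_lt_trans.
rewrite ler_wpM2l ?rho_le_sum // exprn_ge0 //.
exact: le_trans (ltW (rho_gt0 i)) (rho_le_sum i).
Qed.

Lemma interval_cases c d : 0 <= c -> d <= 1 -> gamma <= d - c ->
  exists i : 'I_m, [\/ c <= offset i <= d, c <= offset i + rho i <= d
                     | offset i <= c /\ d <= offset i + rho i].
Proof.
move=> c_ge0 d_le1 cd.
have m_gt0 : (0 < m)%N by apply: leq_trans hm.
(* Take the last cylinder starting at or before [c]. If it ends before [c], the next one starts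
   within [gamma] of that end, hence before [d]. *)
case: (@arg_maxnP 'I_m (Ordinal m_gt0) (fun i => offset i <= c) val) => /=.
  by rewrite offset0.
move=> i le_ic i_max.
have [le_di|lt_id] := leP d (offset i + rho i); first by exists i; apply: Or33.
have [le_ci|lt_ic] := leP c (offset i + rho i).
  by exists i; apply: Or32; rewrite le_ci ltW.
have offi := offsetS i.
have [lt_im|le_mi] := ltnP i.+1 m; last first.
  have eq_im : i.+1 = m by apply/eqP; rewrite eqn_leq ltn_ord.
  by move: offi; rewrite eq_im offset_size => ?; exfalso; lra.
exists (Ordinal lt_im); apply: Or31 => /=; apply/andP; split; last by lra.
rewrite leNgt; apply/negP => lt_i1c.
by have /= := i_max (Ordinal lt_im) (ltW lt_i1c); rewrite ltnn.
Qed.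

(** * Extreme points and holes of [K] *)

Variable K : set R.
Hypothesis hK : self_similar_set phi K.

Lemma self_similar_mem i x : K x -> K (phi i x).
Proof. by case: hK => _ _ KE Kx; rewrite KE; exists i => //; exists x. Qed.

Lemma self_similar_inv x : K x -> exists i y, K y /\ x = phi i y.
Proof.
by case: hK => _ _ {1}-> [i _ [y Ky <-]]; exists i, y.
Qed.

Lemma self_similar_max : exists2 c, K c & forall x, K x -> x <= c.
Proof.
case: hK => K0 Kc _.
have [|c /set_mem Kc' cmax] := @compact_EVT_max _ R idfun K K0 Kc.
  by apply: continuous_subspaceT => x; exact: cvg_id.
by exists c => // x Kx; apply: cmax; rewrite inE.
Qed.

Lemma self_similar_min : exists2 c, K c & forall x, K x -> c <= x.
Proof.
case: hK => K0 Kc _.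
have [|c /set_mem Kc' cmin] := @compact_EVT_min _ R idfun K K0 Kc.
  by apply: continuous_subspaceT => x; exact: cvg_id.
by exists c => // x Kx; apply: cmin; rewrite inE.
Qed.

Lemma self_similar_ge0 x : K x -> 0 <= x.
Proof.
have [c Kc cmin] := self_similar_min.
move=> /cmin; apply: le_trans.
(* The minimum satisfies [c = phi i y >= rho i * c], which forces [c >= 0]. *)
have [i [y [/cmin le_cy cE]]] := self_similar_inv Kc.
move: cE; rewrite ifs_mapE.
have := rho_bounds i; have := offset_ge0 i => ? /andP[? ?] ?.
by nra.
Qed.

Lemma self_similar_le1 x : K x -> x <= 1.
Proof.
have [c Kc cmax] := self_similar_max.
move=> /cmax /le_trans; apply.
have [i [y [/cmax le_yc cE]]] := self_similar_inv Kc.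
move: cE; rewrite ifs_mapE.
have := rho_bounds i; have := offset_end i => ? /andP[? ?] ?.
by nra.
Qed.

Lemma self_similar0 : K 0.
Proof.
have [c Kc cmin] := self_similar_min.
have m_gt0 : (0 < m)%N by apply: leq_trans hm.
have /cmin := self_similar_mem (Ordinal m_gt0) Kc.
rewrite ifs_mapE /= offset0.
have := rho_bounds (Ordinal m_gt0); have := self_similar_ge0 Kc => c_ge0 /andP[? ?] ?.
by have <- : c = 0 by nra.
Qed.

Lemma self_similar1 : K 1.
Proof.
have [c Kc cmax] := self_similar_max.
(* The last map fixes 1, so it would move a maximum below 1 further up. *)
have lt_m : (m.-1 < m)%N by rewrite prednK // (leq_trans _ hm).
pose i := Ordinal lt_m.
have /cmax := self_similar_mem i Kc.
have := offsetS i; rewrite /= prednK ?(leq_trans _ hm) // offset_size ifs_mapE /=.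
have := rho_bounds i; have := self_similar_le1 Kc => c_le1 /andP[? ?] ? ?.
by have <- : c = 1 by nra.
Qed.

(** Either a cylinder endpoint, which is in [K], lies in the interval, or the interval sits in one
    cylinder and is pulled back by [phi i]. Pulling back lengthens it but keeps it inside [0, 1], so
    this stops. *)
Lemma self_similar_meets c d : 0 <= c -> d <= 1 -> gamma <= d - c ->
  exists2 y, K y & c <= y <= d.
Proof.
move=> c_ge0 d_le1 cd.
have [n small] := expr_lambda_small gap_gt0.
have {small} : lambda ^+ n < d - c by apply: lt_le_trans small cd.
elim: n c d c_ge0 d_le1 cd => [|n IHn] c d c_ge0 d_le1 cd small.
  by rewrite expr0 in small; exfalso; lra.
have [i [ci|ci|[le_ic le_di]]] := interval_cases c_ge0 d_le1 cd.
- exists (offset i) => //.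
  by have := self_similar_mem i self_similar0; rewrite ifs_mapE mulr0 add0r.
- exists (offset i + rho i) => //.
  by have := self_similar_mem i self_similar1; rewrite ifs_mapE mulr1 addrC.
have ri_gt0 := rho_gt0 i.
have diffE : (d - offset i) / rho i - (c - offset i) / rho i = (d - c) / rho i.
  by field; rewrite gt_eqF.
have [||||y Ky /andP[le_cy le_yd]] :=
    IHn ((c - offset i) / rho i) ((d - offset i) / rho i).
- by rewrite divr_ge0 ?subr_ge0 // ltW.
- by rewrite ler_pdivrMr // mul1r lerBlDl.
- rewrite diffE ler_pdivlMr // (le_trans _ cd) // ler_piMr ?ltW ?gap_gt0 //.
  by case/andP: (rho_bounds i).
- by rewrite diffE expr_lambda_div.
exists (phi i y); first exact: self_similar_mem.
move: le_cy le_yd; rewrite ler_pdivrMr // ler_pdivlMr // ifs_mapE => ? ?.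
by apply/andP; split; lra.
Qed.

Lemma self_similar_gap (i : 'I_m) z : K z ->
  z <= offset i.+1 - gamma \/ offset i.+1 <= z.
Proof.
case/self_similar_inv => k [y [Ky ->]]; rewrite ifs_mapE.
have ? := self_similar_ge0 Ky; have ? := self_similar_le1 Ky.
have ? := rho_gt0 k; have offk := offsetS k.
have [le_ki|/offset_le ?] := leqP k i; [left|right; nra].
have ? : offset k.+1 <= offset i.+1 by exact: offset_le.
by nra.
Qed.

(** * Similitudes mapping [K] into itself *)

(* Holes of [f(K)] inside its hull have length at most [`|r| * gamma < gamma],
   whereas crossing a first-level gap would require one of length [gamma]. *)
Lemma image_no_straddle (r t x y u : R) : r != 0 -> `|r| < 1 ->
  (forall z, K z -> K (r * z + t)) -> K x -> K y ->
  (forall z, K z -> z <= u \/ u + gamma <= z) ->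
  r * x + t <= u -> u + gamma <= r * y + t -> False.
Proof.
move=> r_neq0 r_lt1 fK Kx Ky gapu le_xu le_uy.
have g_gt0 := gap_gt0.
have [x0 x1] := (self_similar_ge0 Kx, self_similar_le1 Kx).
have [y0 y1] := (self_similar_ge0 Ky, self_similar_le1 Ky).
(* The preimage of the midpoint of the gap: points within [gamma / 2] of [c] are sent strictly
   inside the gap. *)
pose c := (u + gamma / 2 - t) / r.
have cE : r * c = u + gamma / 2 - t by rewrite /c mulrCA divff // mulr1.
(* [x] and [y] lie on opposite sides of [c], each more than [gamma / 2] away since [|r| < 1]. *)
have [c_ge c_le] : 0 <= c - gamma / 2 /\ c + gamma / 2 <= 1.
  move: r_lt1; rewrite ltr_norml => /andP[? ?].
  have hx : r * (x - c) <= - (gamma / 2) by rewrite mulrBr cE; lra.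
  have hy : gamma / 2 <= r * (y - c) by rewrite mulrBr cE; lra.
  have [r_lt0|r_gt0|r0] := ltgtP r 0; last by rewrite r0 eqxx in r_neq0.
    by split; rewrite leNgt; apply/negP => ?; nra.
  by split; rewrite leNgt; apply/negP => ?; nra.
have [|z Kz /andP[le_cz le_zc]] := self_similar_meets c_ge c_le; first by lra.
have near_z : `|r * (z - c)| < gamma / 2.
  rewrite normrM; apply: (@le_lt_trans _ _ (`|r| * (gamma / 2))); last first.
    by rewrite gtr_pMl //; lra.
  by rewrite ler_wpM2l // ler_norml; apply/andP; split; lra.
move: near_z; rewrite ltr_norml mulrBr cE => /andP[? ?].
by have [?|?] := gapu _ (fK _ Kz); lra.
Qed.

Lemma image_in_cylinder (r t : R) : r != 0 -> `|r| < 1 ->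
  (forall z, K z -> K (r * z + t)) ->
  exists i : 'I_m, forall z, K z -> exists2 y, K y & r * z + t = phi i y.
Proof.
move=> r_neq0 r_lt1 fK.
have [i [y0 [Ky0 f0E]]] := self_similar_inv (fK _ self_similar0).
exists i => z Kz.
have [k [y [Ky fzE]]] := self_similar_inv (fK _ Kz).
have bnd (j : 'I_m) w : K w -> offset j <= phi j w <= offset j.+1 - gamma.
  move=> Kw; have ? := self_similar_ge0 Kw; have ? := self_similar_le1 Kw.
  have ? := rho_gt0 j; have ? := offsetS j; rewrite ifs_mapE.
  by apply/andP; split; nra.
(* Stated for any two points, since [f(z)] may fall on either side of the cylinder of [f(0)]. *)
have straddle (j l : 'I_m) v w v' w' : (j < l)%N -> K v -> K w -> K v' -> K w' ->
    r * v + t = phi j v' -> r * w + t = phi l w' -> False.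
  move=> lt_jl Kv Kw Kv' Kw' fvE fwE.
  apply: (@image_no_straddle r t v w (offset j.+1 - gamma)) => //.
  - by move=> q /(self_similar_gap j); rewrite subrK.
  - by rewrite fvE; case/andP: (bnd j v' Kv').
  - rewrite subrK fwE; case/andP: (bnd l w' Kw') => le_l _.
    exact: le_trans (offset_le lt_jl) le_l.
have [lt_ik|lt_ki|/val_inj eq_ik] := ltngtP i k.
- by case: (straddle _ _ _ _ _ _ lt_ik self_similar0 Kz Ky0 Ky f0E fzE).
- by case: (straddle _ _ _ _ _ _ lt_ki Kz self_similar0 Ky Ky0 fzE f0E).
by exists y; rewrite // eq_ik.
Qed.

(** No bound on [|r|] is assumed, because the induction enlarges the ratio until the map is an
    isometry. *)
Lemma similitude_word (r t : R) : r != 0 -> (forall z, K z -> K (r * z + t)) ->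
  exists w, (forall x, r * x + t = phi_word phi w x) \/
    ([set 1 - x | x in K] = K /\ forall x, r * x + t = phi_word phi w (1 - x)).
Proof.
move=> r_neq0 fK.
have [n small] : exists n, lambda ^+ n < `|r|.
  by apply: expr_lambda_small; rewrite normr_gt0.
elim: n r t r_neq0 fK small => [|n IHn] r t r_neq0 fK small;
  have f0 := fK _ self_similar0; have f1 := fK _ self_similar1;
  have [? ?] := (self_similar_ge0 f0, self_similar_le1 f0);
  have [? ?] := (self_similar_ge0 f1, self_similar_le1 f1).
  (* [|r| > 1] is impossible, as [f(0)] and [f(1)] both lie in [0, 1]. *)
  by move: small; rewrite expr0 lter_normr => /orP[] ?; exfalso; lra.
have [r_lt1|r_ge1] := ltP `|r| 1; last first.
  (* Here [f] must permute 0 and 1, so it is the identity or the reflection; the latter makes [K]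
     symmetric. *)
  exists [::] => /=; move: r_ge1; rewrite lter_normr => /orP[] ?.
    have [-> ->] : r = 1 /\ t = 0 by split; lra.
    by left => x; rewrite mul1r addr0.
  have [rE tE] : r = -1 /\ t = 1 by split; lra.
  have flip z : K z -> K (1 - z).
    by move=> /fK; rewrite rE tE mulN1r addrC.
  right; split=> [|x]; last by rewrite rE tE mulN1r addrC.
  apply/seteqP; split=> [_ [x Kx <-]|x Kx]; first exact: flip.
  by exists (1 - x); [exact: flip | rewrite subKr].
have [i fi] := image_in_cylinder r_neq0 r_lt1 fK.
have ri_gt0 := rho_gt0 i.
have ri_neq0 : rho i != 0 by rewrite gt_eqF.
have phiK x : phi i (r / rho i * x + (t - offset i) / rho i) = r * x + t.
  by rewrite ifs_mapE; field.
have [|z Kz||w wE] := IHn (r / rho i) ((t - offset i) / rho i).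
- by rewrite mulf_neq0 // invr_eq0.
- have [y Ky fzE] := fi _ Kz.
  suff -> : r / rho i * z + (t - offset i) / rho i = y by [].
  apply: (mulfI ri_neq0); apply: (addIr (offset i)).
  by rewrite -!ifs_mapE phiK.
- by rewrite normrM normfV (gtr0_norm ri_gt0) expr_lambda_div.
exists (i :: w); case: wE => [wE|[KE wE]]; [left|right; split=> //] => x /=.
  by rewrite -wE phiK.
by rewrite -wE phiK.
Qed.

End EqualGapIFS.

Theorem theorem1p2 (R : realType) (m : nat) (hm : (2 <= m)%N)
    (rho : 'I_m -> R) (rho_bounds : forall i : 'I_m, 0 < rho i < 1)
    (rho_sum : \sum_(i < m) rho i < 1)
    (K : set R) (hK : self_similar_set (ifs_map rho) K)
    (f : R -> R) (hf : contractive_similitude f) (hfK : f @` K `<=` K) :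
  exists w : seq 'I_m,
    [/\ f @` K = phi_word (ifs_map rho) w @` K,
        [set 1 - x | x in K] <> K ->
          forall x : R, f x = phi_word (ifs_map rho) w x
      & [set 1 - x | x in K] = K ->
          (forall x : R, f x = phi_word (ifs_map rho) w x) \/
          (forall x : R, f x = phi_word (ifs_map rho) w (1 - x))].
Proof.
case: hf => r [t [r_gt0 _ fE]].
have [||w wE] := @similitude_word R m rho hm rho_bounds rho_sum K hK r t.
- by rewrite -normr_gt0.
- by move=> z Kz; rewrite -fE; apply: hfK; exists z.
exists w; case: wE => [wE|[KE wE]].
  have fw : f = phi_word (ifs_map rho) w by apply/funext => x; rewrite fE wE.
  by split=> [|_ x|_]; rewrite fw //; left.
split=> [|KN|_]; last by right=> x; rewrite fE wE.
  (* By symmetry of [K], the reflection before [phi_word] does not change the image. *)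
  rewrite -[in RHS]KE image_comp; apply: eq_imagel => x _ /=.
  by rewrite fE wE.
by case: KN.
Qed.
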